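(* Let $m\ge2$, $0\le r\le n$ be integers and let $p$ be $0$ or a prime. Let $A_1,\dots,A_m\subseteq[n]$ be sets of size at most $r$, and set $E=\bigcup_{i=1}^m\{i\}\times A_i\subseteq[m]\times[n]$. Then $E$ is independent in $\mathrm{T}_{m,n}(2,r,p)$ if and only if all of the following hold: \begin{align*} |A_i\cap A_j\cap A_k| &= 0 && \text{for all distinct } i,j,k\in[m],\\ \sum_{1\le i<j\le m}|A_i\cap A_j| + \Big|A_k\setminus\bigcup_{i\in[m]\setminus\{k\}}A_i\Big| &\le r && \text{for all } k\in[m],\\ \sum_{i=1}^m|A_i| &\le 2r. \end{align*}
   Context: Write $[n]=\{1,\dots,n\}$. For integers $0\le s\le m$, $0\le r\le n$ and $p$ equal to $0$ or a prime, the tensor matroid $\mathrm{T}_{m,n}(s,r,p)$ is the following matroid on $[m]\times[n]$. Let $K$ be a field of characteristic $p$ and let $u_1,\dots,u_m\in K^s$, $v_1,\dots,v_n\in K^r$ be vectors all of whose coordinates together are algebraically independent over the prime field. A set $E\subseteq[m]\times[n]$ is independent if and only if the vectors $u_i\otimes v_j$, indexed by $(i,j)\in E$, are linearly independent in $K^s\otimes K^r$. This matroid depends only on $m,n,s,r,p$. *)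

(* Defs.v *)
From HB Require Import structures.
From mathcomp Require Import all_boot all_order all_algebra.
From mathcomp Require Import mpoly mxtens.

Set Implicit Arguments.
Unset Strict Implicit.
Unset Printing Implicit Defensive.

Import GRing.Theory.
Local Open Scope ring_scope.

Definition has_characteristic (p : nat) (K : fieldType) : Prop :=
  if p is 0%N then [pchar K] =i pred0 else p \in [pchar K].

(* Since x / 0 = 0, closure under division needs no condition on y. *)
Definition is_subfield (K : fieldType) (S : K -> Prop) : Prop :=
  [/\ S 1, (forall x y, S x -> S y -> S (x - y))
         & (forall x y, S x -> S y -> S (x / y))].

Definition prime_subfield (K : fieldType) (x : K) : Prop :=
  forall S : K -> Prop, is_subfield S -> S x.

Definition alg_independent_over (K : fieldType) (S : K -> Prop)
    (N : nat) (x : 'I_N -> K) : Prop :=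
  forall P : {mpoly K[N]}, (forall mon, S P@_mon) -> P.@[x] = 0 -> P = 0.

(* The vectors u_i and v_j are the rows of U and V; genericity concerns the
   joint family of all entries of U and V. *)
Definition generic_vectors (K : fieldType) (m n s r : nat)
    (U : 'M[K]_(m, s)) (V : 'M[K]_(n, r)) : Prop :=
  alg_independent_over (@prime_subfield K)
    (fun k : 'I_(m * s + n * r) => row_mx (mxvec U) (mxvec V) 0 k).

(* u_i \otimes v_j as a Kronecker product: K^s \otimes K^r is K^(s * r). *)
Definition tensor_vector (K : fieldType) (m n s r : nat)
    (U : 'M[K]_(m, s)) (V : 'M[K]_(n, r)) (e : 'I_m * 'I_n) : 'rV[K]_(s * r) :=
  row e.1 U *t row e.2 V.

(* Independence in T_{m,n}(s,r,p) is this predicate for any U and V with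
   generic_vectors U V over any field K with has_characteristic p K. *)
Definition tensor_independent (K : fieldType) (m n s r : nat)
    (U : 'M[K]_(m, s)) (V : 'M[K]_(n, r)) (E : {set 'I_m * 'I_n}) : bool :=
  free [seq tensor_vector U V e | e in E].

(* Main.v *)
(* Call a column shared if it lies in two of the A_i, private if it lies in one.

   Sufficiency. By genericity it is enough to find one choice of the v_a for
   which the vectors are independent: a maximal minor is then a polynomial with
   integer coefficients that is nonzero at that choice, hence nonzero at the
   generic point. We keep the u_i and let every v_a be a standard basis vector,
   in such a way that each basis vector e_l is met by at most two vectors
   u_i (x) e_l, with different i; these are independent since the u_i are
   pairwise independent.

   Necessity. The first and the third condition are dimension counts in
   K^2 (x) v_a and K^2 (x) K^r. For the second one, keep only the shared columns
   and the private columns of A_k, and contract K^2 with a nonzero functional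
   vanishing on u_k: the image lies in the span of the shared v_a and the kernel
   has dimension r, so 2 d + b <= r + d, where d and b count the shared columns
   and the private columns of A_k. *)

Require Import Defs.
From mathcomp Require Import all_boot all_order all_algebra.
From mathcomp Require Import mpoly mxtens zify.

Set Implicit Arguments.
Unset Strict Implicit.
Unset Printing Implicit Defensive.

Import GRing.Theory.
Local Open Scope ring_scope.

(** * Linear independence of families indexed by a finite set *)

Section FreeFamily.
Variables (K : fieldType) (T : finType) (N : nat) (f : T -> 'rV[K]_N).

Lemma free_image_row_free (E : {set T}) :
  free [seq f e | e in E] =
  row_free (\matrix_(i < #|E|) f (enum_val i)).
Proof.
have szE : size [seq f e | e in E] == #|E| by rewrite size_map -cardE.
pose X := Tuple szE; rewrite -[image _ _]/(tval X).
have nthX (i : 'I_#|E|) : X`_i = f (enum_val i).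
  rewrite /= (nth_map (enum_val i)) -?cardE //.
  by rewrite -enum_val_nth.
have mulE (v : 'rV_#|E|) : v *m \matrix_(i < #|E|) f (enum_val i) =
    \sum_i v 0 i *: X`_i.
  by rewrite mulmx_sum_row; apply: eq_bigr => i _; rewrite rowK nthX.
apply/freeP/idP => [indep | rf k sum0 i].
  apply: inj_row_free => v; rewrite mulE => /indep v0.
  by apply/rowP=> i; rewrite mxE v0.
have : (\row_j k j) *m (\matrix_(i < #|E|) f (enum_val i)) == 0.
  by apply/eqP; rewrite mulE -[RHS]sum0; apply: eq_bigr => j _; rewrite mxE.
by rewrite mulmx_free_eq0 // => /eqP/rowP/(_ i); rewrite !mxE.
Qed.

Lemma free_imageP (E : {set T}) :
  reflect (forall c : T -> K,
             \sum_(e in E) c e *: f e = 0 -> {in E, forall e, c e = 0})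
          (free [seq f e | e in E]).
Proof.
pose M := \matrix_(i < #|E|) f (enum_val i).
have mulE (v : 'rV_#|E|) (c : T -> K) :
    (forall i, v 0 i = c (enum_val i)) -> v *m M = \sum_(e in E) c e *: f e.
  move=> vc; rewrite big_enum_val mulmx_sum_row.
  by apply: eq_bigr => i _; rewrite rowK vc.
rewrite free_image_row_free -/M; apply: (iffP idP) => [rf c sum0 e eE | indep].
  have : (\row_i c (enum_val i)) *m M == 0.
    by rewrite (mulE _ c) ?sum0 // => i; rewrite mxE.
  rewrite mulmx_free_eq0 // => /eqP/rowP/(_ (enum_rank_in eE e)).
  by rewrite !mxE enum_rankK_in.
(* [c] carries the entries of [v] over to [T], with default 0 outside [E]. *)
apply: inj_row_free => v; pose c e := oapp (v 0) 0
  [pick i | enum_val i == e :> T].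
have vc i : v 0 i = c (enum_val i).
  rewrite /c; case: pickP => [j /eqP/enum_val_inj -> //| /(_ i)].
  by rewrite eqxx.
rewrite (mulE _ c) // => /indep c0.
by apply/rowP => i; rewrite vc c0 ?mxE // enum_valP.
Qed.

Lemma free_imageS (E F : {set T}) :
  F \subset E -> free [seq f e | e in E] -> free [seq f e | e in F].
Proof.
move=> /subsetP sFE /free_imageP indep; apply/free_imageP => c sum0 e eF.
(* A relation on [F] extends by zero to a relation on [E]. *)
have := indep (fun e => if e \in F then c e else 0) _ _ (sFE _ eF).
rewrite eF; apply; rewrite -[RHS]sum0 [RHS]big_mkcond /= [LHS]big_mkcond /=.
apply: eq_bigr => x _; case: ifP => xE; case: ifP => xF; rewrite ?scale0r //.
by rewrite sFE in xE.
Qed.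

End FreeFamily.

(** * Maximal minors and specialization of generic vectors *)

Lemma row_free_minor (K : fieldType) (m n : nat) (A : 'M[K]_(m, n)) :
  row_free A <-> exists g : 'I_m -> 'I_n, \det (colsub g A) != 0.
Proof.
split=> [rfA | [g detA]].
  have fA : row_full A^T by rewrite /row_full mxrank_tr.
  exists (fullrankfun fA); rewrite -unitfE -unitmxE -unitmx_tr -row_free_unit.
  by rewrite trmx_mxsub fullrowsub_free.
rewrite -row_leq_rank; have: colsub g A \in unitmx by rewrite unitmxE unitfE.
rewrite -row_free_unit -row_leq_rank => /leq_trans; apply.
by rewrite -[A]mulmx1 -mulmx_colsub mulmx1 mxrankM_maxl.
Qed.

Section Generic.
Variables (K : fieldType) (m n s r : nat).
Local Notation N := (m * s + n * r)%N.

Definition coord (R : Type) (U : 'M[R]_(m, s)) (V : 'M[R]_(n, r)) : 'I_N -> R :=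
  fun k => row_mx (mxvec U) (mxvec V) 0 k.

Lemma coordU (R : Type) (U : 'M[R]_(m, s)) (V : 'M[R]_(n, r)) i j :
  coord U V (lshift _ (mxvec_index i j)) = U i j.
Proof. by rewrite /coord row_mxEl mxvecE. Qed.

Lemma coordV (R : Type) (U : 'M[R]_(m, s)) (V : 'M[R]_(n, r)) i j :
  coord U V (rshift _ (mxvec_index i j)) = V i j.
Proof. by rewrite /coord row_mxEr mxvecE. Qed.

Lemma prime_subfield_int (z : int) : prime_subfield (z%:~R : K).
Proof.
move=> S [S1 SB _].
have S0 : S 0 by rewrite -(subrr (1 : K)); apply: SB.
have SN x : S x -> S (- x) by rewrite -sub0r; apply: SB.
have Sn k : S (k%:R).
  elim: k => [|k IH] //; rewrite -addn1 natrD -[X in _ + X]opprK.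
  by apply: SB => //; apply: SN.
by case: z => k; [apply: Sn | rewrite NegzE mulrNz; apply/SN/Sn].
Qed.

(** Integer coefficients land in the prime subfield, so if [Q] vanishes at the generic point, its
    image over [K] is the zero polynomial and vanishes at every [y]. *)
Lemma generic_mmap_neq0 (U : 'M[K]_(m, s)) (V : 'M[K]_(n, r))
    (Q : {mpoly int[N]}) (y : 'I_N -> K) :
  generic_vectors U V -> mmap intr y Q != 0 -> mmap intr (coord U V) Q != 0.
Proof.
move=> gen; apply: contra_neq => Qx0; pose P := map_mpoly intr Q : {mpoly K[N]}.
have mmapP x : P.@[x] = mmap intr x Q.
  (* Coefficients may die in positive characteristic, so the sizes of [P] and [Q] can differ; both
     are expanded up to the larger one. *)
  rewrite /meval (mmapE _ (leq_maxl (msize P) (msize Q))).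
  rewrite (mmapE _ (leq_maxr (msize P) (msize Q))).
  by apply: eq_bigr => mon _; rewrite mcoeff_map_mpoly.
rewrite -mmapP (gen P) ?meval0 // => [mon|]; last by rewrite mmapP.
by rewrite mcoeff_map_mpoly; apply: prime_subfield_int.
Qed.

(** Stated over any commutative ring, so that it can also be formed from indeterminates and then
    specialized. *)
Definition tensor_mx (R : comNzRingType) (U : 'M[R]_(m, s)) (V : 'M[R]_(n, r))
    (E : {set 'I_m * 'I_n}) : 'M[R]_(#|E|, s * r) :=
  \matrix_(e, k) (U (enum_val e).1 (mxtens_unindex k).1 *
                  V (enum_val e).2 (mxtens_unindex k).2).

Lemma tensor_vectorE (U : 'M[K]_(m, s)) (V : 'M[K]_(n, r)) e k :
  tensor_vector U V e 0 k =
  U e.1 (mxtens_unindex k).1 * V e.2 (mxtens_unindex k).2.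
Proof. by rewrite !mxE. Qed.

Lemma tensor_independentE (U : 'M[K]_(m, s)) (V : 'M[K]_(n, r)) E :
  tensor_independent U V E = row_free (tensor_mx U V E).
Proof.
rewrite /tensor_independent free_image_row_free; congr row_free.
by apply/matrixP => e k; rewrite mxE tensor_vectorE mxE.
Qed.

Lemma map_tensor_mx (R S : comNzRingType) (f : {rmorphism R -> S}) U V E :
  map_mx f (tensor_mx U V E) = tensor_mx (map_mx f U) (map_mx f V) E.
Proof. by apply/matrixP => e k; rewrite !mxE rmorphM. Qed.

Lemma generic_tensor_independent (U U0 : 'M[K]_(m, s)) (V V0 : 'M[K]_(n, r)) E :
  generic_vectors U V ->
  tensor_independent U0 V0 E -> tensor_independent U V E.
Proof.
move=> gen; rewrite !tensor_independentE !row_free_minor => -[g minor_neq0].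
pose UX : 'M[{mpoly int[N]}]_(m, s) :=
  \matrix_(i, j) 'X_(lshift _ (mxvec_index i j)).
pose VX : 'M[{mpoly int[N]}]_(n, r) :=
  \matrix_(i, j) 'X_(rshift _ (mxvec_index i j)).
have evalE (U1 : 'M[K]_(m, s)) (V1 : 'M[K]_(n, r)) :
    mmap intr (coord U1 V1) (\det (colsub g (tensor_mx UX VX E)))
    = \det (colsub g (tensor_mx U1 V1 E)).
  pose h := mmap intr (coord U1 V1) : {rmorphism {mpoly int[N]} -> K}.
  rewrite -[LHS](det_map_mx h) map_mxsub map_tensor_mx.
  congr (\det (colsub g (tensor_mx _ _ _))).
    by apply/matrixP => i j; rewrite !mxE /h /= mmapX mmap1U coordU.
  by apply/matrixP => i j; rewrite !mxE /h /= mmapX mmap1U coordV.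
exists g; rewrite -evalE; apply: (generic_mmap_neq0 (y := coord U0 V0)) => //.
by rewrite evalE.
Qed.

End Generic.

Lemma generic_rows_independent (K : fieldType) (m n r : nat)
    (U : 'M[K]_(m, 2)) (V : 'M[K]_(n, r)) i j :
  generic_vectors U V -> i != j -> U i 0 * U j 1 - U i 1 * U j 0 != 0.
Proof.
move=> gen neq_ij.
pose X k l : {mpoly int[m * 2 + n * r]} := 'X_(lshift _ (mxvec_index k l)).
pose Q := X i 0 * X j 1 - X i 1 * X j 0.
have evalE (U1 : 'M[K]_(m, 2)) (V1 : 'M[K]_(n, r)) : mmap intr (coord U1 V1) Q =
    U1 i 0 * U1 j 1 - U1 i 1 * U1 j 0 :> K.
  pose h := mmap intr (coord U1 V1) : {rmorphism {mpoly int[m * 2 + n * r]} -> K}.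
  rewrite -[LHS]/(h Q) rmorphB !rmorphM /h /=.
  by rewrite !mmapX !mmap1U !coordU.
(* Specializing row [i] to (1, 0) and row [j] to (0, 1) gives the value 1. *)
rewrite -(evalE U V); pose U0 : 'M[K]_(m, 2) :=
  \matrix_(k, l) (if l == 0 then k == i else k == j)%:R.
apply: (generic_mmap_neq0 (y := coord U0 V)) => //.
rewrite evalE !mxE /= !eqxx [j == i]eq_sym (negPf neq_ij).
by rewrite mulr1 mulr0 subr0 oner_eq0.
Qed.

Lemma sum_mxtens (R : comNzRingType) (s r : nat) (F : 'I_s -> 'I_r -> R) :
  \sum_(k < s * r) F (mxtens_unindex k).1 (mxtens_unindex k).2 =
  \sum_j \sum_l F j l.
Proof.
rewrite pair_big (reindex (@mxtens_index s r)); last first.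
  exists (@mxtens_unindex s r) => k _;
    [exact: mxtens_indexK | exact: mxtens_unindexK].
by apply: eq_bigr => -[j l] _; rewrite mxtens_indexK.
Qed.

(** * Dimension bounds on independent sets *)

Section Dimension.
Variables (K : fieldType) (m n s r : nat).
Variables (U : 'M[K]_(m, s)) (V : 'M[K]_(n, r)).
Implicit Types E F : {set 'I_m * 'I_n}.

Lemma tensor_independentS E F :
  F \subset E -> tensor_independent U V E -> tensor_independent U V F.
Proof. exact: free_imageS. Qed.

Lemma card_tensor_independent E : tensor_independent U V E -> (#|E| <= s * r)%N.
Proof.
rewrite tensor_independentE -row_leq_rank => /leq_trans; apply.
exact: rank_leq_col.
Qed.

(** All the vectors lie in the tensor product of $K^s$ with the line of $v_a$; the matrix factors
    through $K^s$. *)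
Lemma card_tensor_independent_fiber (I : {set 'I_m}) a :
  tensor_independent U V (setX I [set a]) -> (#|I| <= s)%N.
Proof.
rewrite tensor_independentE -row_leq_rank; set F := setX _ _.
have -> : #|I| = #|F| by rewrite cardsX cards1 muln1.
move=> /leq_trans; apply.
pose L := \matrix_(e < #|F|, j < s) U (enum_val e).1 j.
pose P := \matrix_(j < s, k < s * r)
  (((mxtens_unindex k).1 == j)%:R * V a (mxtens_unindex k).2).
have -> : tensor_mx U V F = L *m P.
  apply/matrixP => e k; rewrite !mxE (bigD1 (mxtens_unindex k).1) //= big1.
    rewrite !mxE eqxx mul1r addr0; have := enum_valP e.
    by rewrite !inE => /andP[_ /eqP ->].
  by move=> j; rewrite !mxE eq_sym => /negPf ->; rewrite mul0r mulr0.
exact: leq_trans (mxrankM_maxl _ _) (rank_leq_col _).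
Qed.

(* Contract the first factor with a functional phi: vectors whose u_i lies in
   ker phi vanish, the others land in the span of the v_a with a in S, and the
   kernel of the contraction has codimension r. *)
Lemma card_tensor_independent_contract E (S : {set 'I_n}) (phi : 'I_s -> K)
    (psi : 'I_s -> K) :
  \sum_j psi j * phi j = 1 ->
  (forall i a, (i, a) \in E -> a \notin S -> \sum_j U i j * phi j = 0) ->
  tensor_independent U V E -> (#|E| + r <= s * r + #|S|)%N.
Proof.
move=> psi_phi killed; rewrite tensor_independentE => /eqP rkE.
pose P := \matrix_(k < s * r, l < r)
  (phi (mxtens_unindex k).1 * ((mxtens_unindex k).2 == l)%:R).
have contract (u : 'I_s -> K) (v : 'I_r -> K) l :
    \sum_(k < s * r) u (mxtens_unindex k).1 * v (mxtens_unindex k).2 * P k l =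
    (\sum_j u j * phi j) * v l.
  under eq_bigr do rewrite mxE.
  rewrite (sum_mxtens (fun j l' => u j * v l' * (phi j * (l' == l)%:R))).
  rewrite mulr_suml; apply: eq_bigr => j _; rewrite (bigD1 l) //= big1 ?addr0.
    by rewrite eqxx mulr1 mulrAC.
  by move=> l' /negPf ->; rewrite !mulr0.
have rkP : (r <= \rank P)%N.
  rewrite col_leq_rank; apply/row_fullP.
  (* Tensoring with [psi] is a section of the contraction by [phi], so [P] has rank [r]. *)
  exists (\matrix_(l, k) (psi (mxtens_unindex k).1 *
                          (l == (mxtens_unindex k).2)%:R)).
  apply/matrixP => l l'; rewrite !mxE; under eq_bigr do rewrite mxE.
  by rewrite (contract psi (fun l2 => (l == l2)%:R)) psi_phi mul1r.
have rkMP : (\rank (tensor_mx U V E *m P) <= #|S|)%N.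
  apply: leq_trans (rank_leq_row (rowsub (fun x : 'I_#|S| => enum_val x) V)).
  apply/mxrankS/row_subP => e.
  have -> : row e (tensor_mx U V E *m P) =
      (\sum_j U (enum_val e).1 j * phi j) *: row (enum_val e).2 V.
    apply/rowP => l; rewrite !mxE; under eq_bigr do rewrite [X in X * _]mxE.
    by rewrite (contract (U _) (V _)).
  have [aS | aNS] := boolP ((enum_val e).2 \in S); last first.
    have := enum_valP e; case: (enum_val e) aNS => i a /= aNS /killed -> //.
    by rewrite scale0r sub0mx.
  apply: scalemx_sub.
  have <- : row (enum_rank_in aS (enum_val e).2)
      (rowsub (fun x : 'I_#|S| => enum_val x) V) = row (enum_val e).2 V.
    by rewrite row_rowsub enum_rankK_in.
  exact: row_sub.
have rkI : (\rank (tensor_mx U V E :&: kermx P) <= s * r - \rank P)%N.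
  by rewrite -mxrank_ker mxrankS // capmxSr.
(* Rank-nullity: [#|E|] is the dimension of the contracted row space plus that of its intersection
   with the kernel. *)
rewrite -{1}rkE -(mxrank_mul_ker _ P) -addnA.
 rewrite addnC leq_add // (leq_trans (leq_add rkI rkP)) //.
by rewrite subnK // rank_leq_row.
Qed.

End Dimension.

Lemma exists_neq_ord (m : nat) (i : 'I_m) :
  (1 < m)%N -> exists k : 'I_m, k != i.
Proof.
move=> m_gt1; have: (0 < #|[set~ i]|)%N by rewrite cardsC1 card_ord; lia.
by case/card_gt0P => k; rewrite !inE; exists k.
Qed.

(** * Counting shared and private columns *)

Section Incidence.
Variables (m n : nat) (A : 'I_m -> {set 'I_n}).

Definition incidence : {set 'I_m * 'I_n} := \bigcup_(i < m) setX [set i] (A i).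

Lemma mem_incidence i a : ((i, a) \in incidence) = (a \in A i).
Proof.
apply/bigcupP/idP => [[j _] | aAi]; first by rewrite !inE => /andP[/eqP /= ->].
by exists i => //; rewrite !inE eqxx.
Qed.

Lemma card_incidence : #|incidence| = (\sum_(i < m) #|A i|)%N.
Proof.
rewrite -sum1_card partition_disjoint_bigcup => [|i j neq_ij].
  by apply: eq_bigr => i _; rewrite sum1_card cardsX cards1 mul1n.
apply/pred0P => -[k a]; rewrite !inE /=; apply/negP.
by move=> /andP[/andP[/eqP -> _] /andP[/eqP eq_ij _]]; rewrite eq_ij eqxx in neq_ij.
Qed.

Definition shared : {set 'I_n} :=
  [set a | [exists i, [exists j, (i != j) && (a \in A i :&: A j)]]].

Lemma mem_shared i j a : i != j -> a \in A i -> a \in A j -> a \in shared.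
Proof.
move=> neq_ij aAi aAj; rewrite inE; apply/existsP; exists i; apply/existsP; exists j.
by rewrite neq_ij inE aAi.
Qed.

(** A column of [A k] is shared exactly when some other [A i] contains it. *)
Lemma setD_bigcup_shared k :
  A k :\: \bigcup_(i < m | i != k) A i = A k :\: shared.
Proof.
apply/setP => a; rewrite !in_setD; have [aAk|] := boolP (a \in A k); last by rewrite !andbF.
rewrite !andbT; congr (~~ _); apply/bigcupP/idP => [[i neq_ik aAi]|].
  exact: mem_shared neq_ik aAi aAk.
rewrite inE => /existsP[i /existsP[j /andP[neq_ij]]]; rewrite inE => /andP[aAi aAj].
have [eq_ik | neq_ik] := eqVneq i k; last by exists i.
by exists j; rewrite // -eq_ik eq_sym.
Qed.

Hypothesis triple_free : forall i j k : 'I_m, i != j -> i != k -> j != k ->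
  #|A i :&: A j :&: A k| = 0%N.

Lemma sharedP a : a \in shared ->
  exists i j : 'I_m, (i < j)%N /\ forall k, (a \in A k) = (k \in [set i; j]).
Proof.
rewrite inE => /existsP[i /existsP[j /andP[neq_ij]]]; rewrite inE => /andP[aAi aAj].
have memA k : (a \in A k) = (k \in [set i; j]).
  apply/idP/idP => [aAk | /set2P[] -> //]; rewrite !inE; apply/norP => -[ki kj].
  rewrite eq_sym in ki; rewrite eq_sym in kj.
  have /eqP := triple_free neq_ij ki kj; rewrite cards_eq0 => /eqP/setP/(_ a).
  by rewrite !inE aAi aAj aAk.
case: (ltngtP i j) => [ltij | ltji | /val_inj eq_ij].
- by exists i, j.
- by exists j, i; split=> // k; rewrite memA setUC.
- by rewrite eq_ij eqxx in neq_ij.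
Qed.

Lemma card_sum_mem (T : finType) (B : {set T}) : #|B| = (\sum_a (a \in B))%N.
Proof. by rewrite -sum1_card big_mkcond /=; apply: eq_bigr => a _; case: ifP. Qed.

(** Double counting: by [sharedP] each shared column is counted for exactly one ordered pair. *)
Lemma sum_card_pair_meets :
  (\sum_(i < m) \sum_(j < m | i < j) #|A i :&: A j|)%N = #|shared|.
Proof.
rewrite pair_big_dep /=; under eq_bigr do rewrite card_sum_mem.
rewrite exchange_big [RHS]card_sum_mem /=; apply: eq_bigr => a _.
have [aS | aNS] := boolP (a \in shared).
  have [i [j [ltij memA]]] := sharedP aS.
  rewrite (bigD1 (i, j)) //= inE !memA !inE !eqxx orbT big1 // => -[k l] /=.
  move=> /andP[ltkl neq]; apply/eqP; rewrite eqb0 inE !memA !inE; apply: contra neq.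
  move=> /andP[/orP[]/eqP ? /orP[]/eqP ?]; subst => //; move: ltij ltkl; lia.
apply: big1 => -[i j] /= ltij; apply/eqP; rewrite eqb0; apply: contra aNS.
rewrite inE => /andP[]; apply: mem_shared; apply: contraTneq ltij => ->.
by rewrite ltnn.
Qed.

Lemma sum_card_shared : (\sum_(i < m) #|A i :&: shared|)%N = (2 * #|shared|)%N.
Proof.
under eq_bigr do rewrite card_sum_mem.
rewrite exchange_big [in RHS]card_sum_mem big_distrr /=; apply: eq_bigr => a _.
have [aS | aNS] := boolP (a \in shared); last first.
  by rewrite big1 ?muln0 // => i _; rewrite in_setI (negPf aNS) andbF.
have [i [j [ltij memA]]] := sharedP aS.
have neq_ij : i != j by apply: contraTneq ltij => ->; rewrite ltnn.
have <- : #|[set i; j]| = (2 * true)%N by rewrite cards2 neq_ij.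
by rewrite card_sum_mem; apply: eq_bigr => k _; rewrite in_setI aS andbT memA.
Qed.

End Incidence.

(** * Distributing the columns over basis vectors *)

Lemma residue_pigeonhole (p x y z : nat) :
  (x < 2 * p)%N -> (y < 2 * p)%N -> (z < 2 * p)%N -> (0 < p)%N -> y <> z ->
  y = z %[mod p] -> x = z %[mod p] -> x = y \/ x = z.
Proof.
move=> ltx lty ltz p_gt0; rewrite -!ltn_divLR // in ltx lty ltz.
rewrite (divn_eq x p) (divn_eq y p) (divn_eq z p).
rewrite !modnMDl !modn_mod => neq eqyz eqxz; rewrite eqyz eqxz in neq *.
(* The quotients by [p] are 0 or 1, and those of [y] and [z] differ, so [x] shares its quotient with
   one of them. *)
case: (x %/ p)%N ltx => [|[|//]] _; case: (y %/ p)%N lty neq => [|[|//]] _;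
  case: (z %/ p)%N ltz => [|[|//]] _ neq;
  by [case: neq | left | right].
Qed.

Section Assignment.
Variables (m n r : nat) (A : 'I_m -> {set 'I_n}).
Hypothesis m_gt1 : (2 <= m)%N.
Hypothesis triple_free : forall i j k : 'I_m, i != j -> i != k -> j != k ->
  #|A i :&: A j :&: A k| = 0%N.
Hypothesis shared_private_le : forall k, (#|shared A| + #|A k :\: shared A| <= r)%N.
Hypothesis total_le : (\sum_(i < m) #|A i| <= 2 * r)%N.

Local Notation S := (shared A).
Local Notation B i := (A i :\: shared A).
Local Notation q := (r - #|shared A|)%N.

(** Row [i] starts at [offset i] in the row-by-row list of private columns. *)
Let offset (i : 'I_m) : nat := (\sum_(j < m | j < i) #|B j|)%N.
Let position (i : 'I_m) (a : 'I_n) : nat := (offset i + index a (enum (B i)))%N.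

Let position_offset i a : a \in B i -> (position i a < offset i + #|B i|)%N.
Proof. by move=> aBi; rewrite ltn_add2l cardE index_mem mem_enum. Qed.

Let offset_le (i j : 'I_m) : (i < j)%N -> (offset i + #|B i| <= offset j)%N.
Proof.
move=> ltij; rewrite /offset [leqRHS](bigD1 i) //= addnC leq_add2l.
rewrite big_mkcond [leqRHS]big_mkcond leq_sum //= => k _.
by case: (boolP (k < i)%N) => // ltki; rewrite (ltn_trans ltki ltij) neq_ltn ltki.
Qed.

Let position_inj i j a b : a \in B i -> b \in B j ->
  position i a = position j b -> (i, a) = (j, b).
Proof.
move=> aBi bBj eqp; have := position_offset aBi; have := position_offset bBj.
case: (ltngtP i j) => [/offset_le | /offset_le | /val_inj eqij].
- by move: eqp; rewrite /position; lia.
- by move: eqp; rewrite /position; lia.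
move=> _ _; move: eqp aBi bBj; rewrite -eqij => /addnI eqp aBi bBj.
by rewrite (index_inj _ _ _ eqp) ?mem_enum.
Qed.

(** Shared columns use up [2 * #|S|] of the total, which is at most [2 * r]. *)
Let position_lt i a : a \in B i -> (position i a < 2 * q)%N.
Proof.
move=> aBi; apply: leq_trans (position_offset aBi) _.
have: (\sum_(k < m) #|B k| <= 2 * q)%N.
  have := sum_card_shared triple_free; move: total_le.
  have -> : (\sum_(k < m) #|A k| =
             \sum_(k < m) #|A k :&: S| + \sum_(k < m) #|B k|)%N.
    by rewrite -big_split; apply: eq_bigr => k _; rewrite /= cardsID.
  lia.
apply: leq_trans; rewrite [leqRHS](bigD1 i) //= addnC leq_add2l /offset.
rewrite big_mkcond [leqRHS]big_mkcond leq_sum //= => k _.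
by case: (boolP (k < i)%N) => // ltki; rewrite neq_ltn ltki.
Qed.

(** The positions of one row fill an interval of length at most [q]. *)
Let position_mod_inj i a b : a \in B i -> b \in B i ->
  position i a = position i b %[mod q] -> a = b.
Proof.
move=> aBi bBi eqm; suff /(position_inj aBi bBi)[] : position i a = position i b.
  by [].
have := position_offset aBi; have := position_offset bBi; move: eqm.
have := shared_private_le i; rewrite /position; move: (index a _) (index b _) => x y.
wlog lexy : x y / (x <= y)%N.
  move=> wl hq eqm hx hy; case: (leqP x y) => [lexy | /ltnW leyx].
    exact: wl.
  by rewrite (wl y x).
move=> hq /eqP; rewrite eq_sym eqn_mod_dvd ?leq_add2l // subnDl => dvd hy hx.
suff : (y - x == 0)%N by lia.
by apply: contraTT dvd; rewrite -lt0n => gt0; rewrite gtnNdvd //; lia.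
Qed.

(* Shared columns get basis vectors of their own; the private columns, listed
   row by row, are wrapped around the remaining [q] basis vectors. Each row has
   at most [q] private columns and there are at most [2 * q] in all, so a basis
   vector is used at most twice, and then by different rows. *)
Lemma basis_assignment : exists f : 'I_n -> nat,
  (forall i a, a \in A i -> (f a < r)%N) /\
  (forall i a, a \in A i -> exists2 k : 'I_m, k != i &
     forall j b, b \in A j -> f b = f a -> j = k \/ (j, b) = (i, a)).
Proof.
(* The default 0 only concerns columns outside every [A i]. *)
pose f a := if a \in S then index a (enum S) else
  if [pick i | a \in A i] is Some i then (#|S| + position i a %% q)%N else 0%N.
have fS a : a \in S -> f a = index a (enum S) by rewrite /f => ->.
have fS_lt a : a \in S -> (f a < #|S|)%N.
  by move=> aS; rewrite fS // cardE index_mem mem_enum.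
have fB i a : a \in B i -> f a = (#|S| + position i a %% q)%N.
  rewrite inE => /andP[aNS aAi]; rewrite /f (negPf aNS).
  case: pickP => [j aAj | /(_ i)]; last by rewrite aAi.
  have [-> // | neq_ij] := eqVneq j i.
  by rewrite (mem_shared neq_ij aAj aAi) in aNS.
have q_gt0 i a : a \in B i -> (0 < q)%N by move=> /position_lt; lia.
have inB i a : a \in A i -> a \notin S -> a \in B i by move=> ? ?; apply/setDP.
exists f; split=> i a aAi; have [aS | /(inB _ _ aAi) aBi] := boolP (a \in S).
- by apply: leq_trans (fS_lt a aS) _; have := shared_private_le i; lia.
- by rewrite (fB _ _ aBi) -ltn_subRL ltn_mod; apply: q_gt0 aBi.
- have [k neq_ki memA] : exists2 k, k != i & forall j, a \in A j -> j = k \/ j = i.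
    have [i1 [i2 [lt12 memA]]] := sharedP triple_free aS.
    have neq12 : i1 != i2 by apply: contraTneq lt12 => ->; rewrite ltnn.
    have := aAi; rewrite memA => /set2P[] ->.
      by exists i2; rewrite 1?eq_sym // => j; rewrite memA => /set2P[]; auto.
    by exists i1 => // j; rewrite memA => /set2P[]; auto.
  exists k => // j b bAj eqf; have eqab : b = a.
    have [bS | /(inB _ _ bAj) bBj] := boolP (b \in S).
      rewrite (fS _ bS) (fS _ aS) in eqf.
      by rewrite (index_inj _ _ _ eqf) ?mem_enum.
    by have := fS_lt a aS; rewrite -eqf (fB _ _ bBj); lia.
  by move: bAj; rewrite eqab => /memA[] ->; auto.
(* A clash is another private incidence on the same basis vector. Its row serves as [k]; without a
   clash, any row other than [i] does. *)
pose clash (jb : 'I_m * 'I_n) :=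
  [&& jb.2 \in B jb.1, f jb.2 == f a & jb != (i, a)].
have inB_clash j b : b \in A j -> f b = f a -> b \in B j.
  move=> bAj eqf; apply: (inB) => //; apply/negP => /fS_lt.
  by rewrite eqf (fB _ _ aBi); lia.
case: (pickP clash) => [[k c] /and3P[/= cBk /eqP eqfc neq] | no_clash]; last first.
  have [k neq_ki] := exists_neq_ord i m_gt1.
  exists k => // j b bAj eqf; right; apply/eqP; have := no_clash (j, b).
  by rewrite /clash /= (inB_clash j b) // eqf eqxx /= => /negbFE.
have eq_mod j b : b \in B j -> f b = f a -> position j b = position i a %[mod q].
  by move=> bBj; rewrite (fB _ _ bBj) (fB _ _ aBi) => /addnI.
exists k => [|j b bAj eqf].
  apply: contraNneq neq => eq_ki; rewrite eq_ki in cBk *.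
  by rewrite (position_mod_inj cBk aBi) //; apply: eq_mod.
have bBj := inB_clash _ _ bAj eqf.
(* Three positions below [2 * q] in one residue class modulo [q] cannot all be distinct. *)
have [eqji|] : position j b = position k c \/ position j b = position i a.
- have := eq_mod _ _ bBj eqf; have := eq_mod _ _ cBk eqfc.
  have : position k c <> position i a by move/(position_inj cBk aBi)/eqP; apply/negP.
  have := q_gt0 _ _ aBi; move: (position_lt bBj) (position_lt cBk) (position_lt aBi).
  exact: residue_pigeonhole.
- by left; case: (position_inj bBj cBk eqji).
by right; apply: position_inj.
Qed.

End Assignment.

(** In the slice of a relation at the basis vector [f a], only $u_i$ and possibly $u_k$ occur; a
    functional vanishing at $u_k$ isolates the coefficient of [(i, a)]. *)
Lemma tensor_independent_assignment (K : fieldType) (m n r : nat)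
    (U : 'M[K]_(m, 2)) (A : 'I_m -> {set 'I_n}) (f : 'I_n -> nat) :
  (forall i j, i != j -> U i 0 * U j 1 - U i 1 * U j 0 != 0) ->
  (forall i a, a \in A i -> (f a < r)%N) ->
  (forall i a, a \in A i -> exists2 k : 'I_m, k != i &
     forall j b, b \in A j -> f b = f a -> j = k \/ (j, b) = (i, a)) ->
  tensor_independent U (\matrix_(a < n, l < r) (f a == l)%:R) (incidence A).
Proof.
move=> detU f_lt f_inj; apply/free_imageP => c sum0 [i a].
rewrite mem_incidence => aAi; have [k neq_ki only_k] := f_inj i a aAi.
have coord0 t : \sum_(e in incidence A) c e * (U e.1 t * (f e.2 == f a)%:R) = 0.
  have /rowP/(_ (mxtens_index (t, Ordinal (f_lt i a aAi)))) := sum0.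
  rewrite summxE [in RHS]mxE => {2}<-; apply: eq_bigr => e _.
  by rewrite [RHS]mxE tensor_vectorE mxtens_indexK mxE.
have iaE : (i, a) \in incidence A by rewrite mem_incidence.
(* The functional applied is the determinant against $u_k$. *)
have : \sum_(e in incidence A)
    c e * ((U e.1 0 * U k 1 - U e.1 1 * U k 0) * (f e.2 == f a)%:R) = 0.
  rewrite (eq_bigr (fun e => c e * (U e.1 0 * (f e.2 == f a)%:R) * U k 1 -
                             c e * (U e.1 1 * (f e.2 == f a)%:R) * U k 0)).
    by rewrite sumrB -!mulr_suml !coord0 !mul0r subr0.
  move=> e _; rewrite mulrBl mulrBr -!mulrA.
  by congr (_ * (_ * _) - _ * (_ * _)); rewrite mulrC.
rewrite (bigD1 (i, a)) //= big1 ?addr0 => [|[j b] /andP[]].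
  rewrite eqxx mulr1 => /eqP.
  rewrite mulf_eq0 [X in _ || X](negPf _) ?orbF; first by move/eqP.
  by apply: detU; rewrite eq_sym.
rewrite mem_incidence => bAj neq /=; case: eqP => [eqf | _]; last by rewrite !mulr0.
have [-> | eq_jb] := only_k j b bAj eqf; last by rewrite eq_jb eqxx in neq.
by rewrite [U k 1 * _]mulrC subrr mul0r mulr0.
Qed.

(** * Both directions of the criterion *)

Theorem proposition3p3 (m n r p : nat)
    (hm : (2 <= m)%N) (hr : (r <= n)%N) (hp : p = 0%N \/ prime p)
    (K : fieldType) (hK : has_characteristic p K)
    (U : 'M[K]_(m, 2)) (V : 'M[K]_(n, r)) (hUV : generic_vectors U V)
    (A : 'I_m -> {set 'I_n}) (hA : forall i, (#|A i| <= r)%N) :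
  tensor_independent U V (\bigcup_(i < m) setX [set i] (A i)) <->
  [/\ (forall i j k : 'I_m, i != j -> i != k -> j != k ->
         #|A i :&: A j :&: A k| = 0%N),
      (forall k : 'I_m,
         (\sum_(i < m) \sum_(j < m | i < j) #|A i :&: A j|
          + #|A k :\: \bigcup_(i < m | i != k) A i| <= r)%N)
    & (\sum_(i < m) #|A i| <= 2 * r)%N].
Proof.
rewrite -/(incidence A); split=> [indep | [triple_free pairs_le total_le]]; last first.
  have [|f [f_lt f_inj]] := basis_assignment hm triple_free _ total_le.
    by move=> k; rewrite -setD_bigcup_shared -sum_card_pair_meets.
  apply: (generic_tensor_independent hUV).
  apply: tensor_independent_assignment f_lt f_inj => i j.
  exact: generic_rows_independent hUV.
have triple_free i j k : i != j -> i != k -> j != k -> #|A i :&: A j :&: A k| = 0%N.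
  move=> neq_ij neq_ik neq_jk; apply/eqP; rewrite cards_eq0; apply/set0Pn => -[a].
  rewrite !inE => /andP[/andP[aAi aAj] aAk].
  (* A column in three sets would give three independent vectors in a plane. *)
  suff /card_tensor_independent_fiber : tensor_independent U V
      (setX (k |: [set i; j]) [set a]).
    by rewrite cardsU1 cards2 !inE neq_ij ![k == _]eq_sym (negPf neq_ik) (negPf neq_jk).
  apply: tensor_independentS indep; apply/subsetP => -[l b].
  by rewrite mem_incidence !inE /= => /andP[/or3P[] /eqP -> /eqP ->].
split=> // [k|]; last by rewrite -card_incidence (card_tensor_independent indep).
rewrite setD_bigcup_shared sum_card_pair_meets //.
(* [A'] keeps the shared columns in all rows and the private ones in row [k] only. *)
pose A' i := if i == k then A k else A i :&: shared A.
have card_A' : #|incidence A'| = (2 * #|shared A| + #|A k :\: shared A|)%N.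
  rewrite card_incidence -sum_card_shared // (bigD1 k) //= [in RHS](bigD1 k) //=.
  rewrite {1}/A' eqxx -(cardsID (shared A) (A k)) addnAC; congr (_ + _ + _)%N.
  by apply: eq_bigr => i /negPf neq_ik; rewrite /A' neq_ik.
have [l neq_lk] := exists_neq_ord k hm.
have det_neq0 := generic_rows_independent hUV neq_lk.
(* [phi] is the determinant against $u_k$; [psi] is $u_l$ rescaled so that [phi] takes the value 1
   on it. *)
pose phi (j : 'I_2) := if j == 0 then U k 1 else - U k 0.
pose psi j := (U l 0 * U k 1 - U l 1 * U k 0)^-1 * U l j.
have sum_phi (u : 'I_2 -> K) : \sum_j u j * phi j = u 0 * U k 1 - u 1 * U k 0.
  by rewrite big_ord_recl big_ord1 /phi /= mulrN; congr (_ - u _ * _); apply: val_inj.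
have psi_phi : \sum_j psi j * phi j = 1.
  by rewrite sum_phi /psi -!mulrA -mulrBr mulVf.
have killed i a : (i, a) \in incidence A' -> a \notin shared A ->
    \sum_j U i j * phi j = 0.
  rewrite mem_incidence sum_phi /A'; case: eqP => [-> _ _ | _].
    by rewrite mulrC subrr.
  by rewrite in_setI => /andP[_ ->].
suff /(card_tensor_independent_contract psi_phi killed) :
    tensor_independent U V (incidence A') by rewrite card_A'; lia.
apply: tensor_independentS indep; apply/subsetP => -[i a].
rewrite !mem_incidence /A'; case: eqP => [-> // | _].
by rewrite in_setI => /andP[].
Qed.
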